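(* Let $K$ be a field with a nonarchimedean valuation $\mathrm{val}:K^*\to\mathbb{R}$ (with $\mathrm{val}(0)=\infty$) whose residue field has characteristic different from $2$ and $3$; extend $\mathrm{val}$ to the algebraic closure $\overline{K}$. Let $\iota,a\in K$ be scalars with $\mathrm{val}(\iota)<0$ and $\mathrm{val}(a)+\mathrm{val}(\iota)>0$. Then there exist precisely six elements $b\in\overline{K}$, which are among the solutions of an equation of degree $12$ in $b$ over $K$, such that the cubic $$g = a(x^3+y^3+z^3)+b(x^2y+x^2z+xy^2+xz^2+y^2z+yz^2)+xyz$$ has $j$-invariant $j(g)=\iota$ and is in symmetric honeycomb form.
   Context: A ternary cubic $f = c_{300}x^3+c_{210}x^2y+c_{120}xy^2+c_{030}y^3+c_{021}y^2z+c_{012}yz^2+c_{003}z^3+c_{102}xz^2+c_{201}x^2z+c_{111}xyz$ is in honeycomb form if the following nine scalars have positive valuation (denominators nonzero; the valuation of $0$ is $\infty$): (A) $\frac{c_{021}c_{102}}{c_{111}c_{012}},\ \frac{c_{012}c_{120}}{c_{111}c_{021}},\ \frac{c_{201}c_{012}}{c_{111}c_{102}},\ \frac{c_{210}c_{021}}{c_{111}c_{120}},\ \frac{c_{102}c_{210}}{c_{111}c_{201}},\ \frac{c_{120}c_{201}}{c_{111}c_{210}}$; (B) $\frac{c_{111}c_{003}}{c_{012}c_{102}},\ \frac{c_{111}c_{030}}{c_{021}c_{120}},\ \frac{c_{111}c_{300}}{c_{201}c_{210}}$. It is in symmetric honeycomb form if the six scalars in (A) have the same positive valuation and the three scalars in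 (B) have the same positive valuation (possibly $\infty$). The $j$-invariant $j(f)$ of a nonsingular cubic is the usual $j$-invariant of the elliptic curve $V(f)\subset\mathbb{P}^2$ (normalized so that $y^2=x^3+x$ has $j=1728$). *)

(* Defs.v *)
From HB Require Import structures.
(* Importing mpoly after the classical libraries fails (clashing notation levels). *)
From mathcomp Require Import all_boot all_order all_algebra ring_quotient mpoly.
From mathcomp Require Import reals constructive_ereal.

Set Implicit Arguments.
Unset Strict Implicit.
Unset Printing Implicit Defensive.

Import Order.TTheory GRing.Theory Num.Theory.

Local Open Scope ring_scope.

Record valuation (R : realType) (K : fieldType) := Valuation {
  vfun :> K -> \bar R;
  valuation0 : vfun 0 = +oo%E;
  valuation_fin : forall x, x != 0 -> vfun x \is a fin_num;
  valuationM : forall x y, vfun (x * y) = (vfun x + vfun y)%E;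
  valuationD : forall x y, (Order.min (vfun x) (vfun y) <= vfun (x + y))%E
}.

Section ResidueField.
Context (R : realType) (K : fieldType) (v : valuation R K).
Local Open Scope ereal_scope.

Lemma valuation1 : v 1%R = 0.
Proof.
have := valuationM v 1%R 1%R; rewrite mulr1.
have := valuation_fin v (oner_neq0 K); case: (v 1%R) => // r _.
by rewrite -EFinD => -[/eqP]; rewrite -subr_eq subrr => /eqP <-.
Qed.

Lemma valuationN1 : v (-1)%R = 0.
Proof.
have := valuationM v (-1)%R (-1)%R; rewrite mulrNN mulr1 valuation1.
have n10 : (-1 : K)%R != 0%R by rewrite oppr_eq0 oner_neq0.
have := valuation_fin v n10; case: (v (-1)%R) => // r _.
rewrite -EFinD => -[/esym/eqP]; rewrite -mulr2n mulrn_eq0 /= => /eqP ->.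
by [].
Qed.

Lemma valuationN x : v (- x)%R = v x.
Proof. by rewrite -mulN1r valuationM valuationN1 add0e. Qed.

Lemma valuationV x : v x = 0 -> v x^-1%R = 0.
Proof.
move=> vx; have x0 : x != 0%R by apply: contra_eq_neq vx => ->; rewrite valuation0.
by have := valuationM v x x^-1; rewrite vx add0e mulfV // valuation1.
Qed.

Definition valuation_ring : {pred K} := fun x => 0 <= v x.

Lemma valuation_ring_subproof : subring_closed valuation_ring.
Proof.
split=> [|x y xv yv|x y xv yv]; rewrite unfold_in /valuation_ring.
- by rewrite valuation1.
- apply: le_trans (valuationD v _ _); rewrite valuationN le_min.
  by apply/andP; split.
- by rewrite valuationM; apply: adde_ge0.
Qed.

HB.instance Definition _ :=
  GRing.isSubringClosed.Build K valuation_ring valuation_ring_subproof.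

Record valring := Valring { vrval : K; _ : vrval \in valuation_ring }.

HB.instance Definition _ := [isSub for vrval].
HB.instance Definition _ := [Choice of valring by <:].
HB.instance Definition _ := [SubChoice_isSubComNzRing of valring by <:].

Definition valuation_ideal : {pred valring} := fun x => 0 < v (vrval x).

Lemma valuation_ideal_subproof : idealr_closed valuation_ideal.
Proof.
split=> [||x y z].
- by rewrite unfold_in /valuation_ideal /= valuation0 ltry.
- by rewrite unfold_in /valuation_ideal /= valuation1 ltxx.
rewrite !unfold_in /valuation_ideal /= => yv zv; apply: lt_le_trans (valuationD v _ _).
rewrite lt_min zv andbT valuationM.
by apply: lte_paddl yv; exact: (valP x).
Qed.

HB.instance Definition _ :=
  isIdealr.Build valring valuation_ideal valuation_ideal_subproof.

Definition residue_field := {ideal_quot valuation_ideal}.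
HB.instance Definition _ := GRing.ComNzRing.on residue_field.

Local Open Scope quotient_scope.
Local Notation pi := (\pi_({ideal_quot valuation_ideal})).

Definition residue_inv (x : residue_field) : residue_field :=
  if x == 0%R then 0%R else pi (insubd (0%R : valring) (vrval (repr x))^-1%R).

Lemma residue_mulVf (x : residue_field) :
  x != 0%R -> (residue_inv x * x)%R = 1%R.
Proof.
move=> x0; rewrite /residue_inv (negPf x0).
have vx : v (vrval (repr x)) = 0.
  apply/eqP; rewrite eq_le; apply/andP; split; last exact: (valP (repr x)).
  rewrite leNgt; apply: contra x0 => vx.
  by rewrite -[x]reprK -[0%R](rmorph0 pi) -Quotient.idealrBE subr0.
have x0' : vrval (repr x) != 0%R.
  by apply: contra_eq_neq vx => ->; rewrite valuation0.
rewrite -[X in (_ * X)%R]reprK -[1%R](rmorph1 pi).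
rewrite -[LHS](rmorphM pi); congr pi; apply: val_inj => /=.
have xV : (vrval (repr x))^-1%R \in valuation_ring.
  by rewrite unfold_in /valuation_ring valuationV.
by rewrite (insubdK _ xV) mulVf.
Qed.

Lemma residue_inv0 : residue_inv 0%R = 0%R.
Proof. by rewrite /residue_inv eqxx. Qed.

HB.instance Definition _ :=
  GRing.ComNzRing_isField.Build residue_field residue_mulVf residue_inv0.

End ResidueField.

Arguments valuation_ring {R K} v _.
Arguments valuation_ideal {R K} v _.

Section TernaryCubics.
Context (L : fieldType).

Local Notation X := ('X_(@Ordinal 3 0 isT) : {mpoly L[3]}).
Local Notation Y := ('X_(@Ordinal 3 1 isT) : {mpoly L[3]}).
Local Notation Z := ('X_(@Ordinal 3 2 isT) : {mpoly L[3]}).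

(* The coefficient c_{ijk} of x^i y^j z^k. *)
Definition cf (f : {mpoly L[3]}) (i j k : nat) : L :=
  f@_[multinom [tuple i; j; k]].

Definition symmetric_cubic (a b : L) : {mpoly L[3]} :=
  a *: (X ^+ 3 + Y ^+ 3 + Z ^+ 3)
  + b *: (X ^+ 2 * Y + X ^+ 2 * Z + X * Y ^+ 2 + X * Z ^+ 2
          + Y ^+ 2 * Z + Y * Z ^+ 2)
  + X * Y * Z.

(* A scalar of the honeycomb conditions is given as (numerator, denominator). *)
Definition honeycombA (f : {mpoly L[3]}) : seq (L * L) :=
  [:: (cf f 0 2 1 * cf f 1 0 2, cf f 1 1 1 * cf f 0 1 2);
      (cf f 0 1 2 * cf f 1 2 0, cf f 1 1 1 * cf f 0 2 1);
      (cf f 2 0 1 * cf f 0 1 2, cf f 1 1 1 * cf f 1 0 2);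
      (cf f 2 1 0 * cf f 0 2 1, cf f 1 1 1 * cf f 1 2 0);
      (cf f 1 0 2 * cf f 2 1 0, cf f 1 1 1 * cf f 2 0 1);
      (cf f 1 2 0 * cf f 2 0 1, cf f 1 1 1 * cf f 2 1 0)].

Definition honeycombB (f : {mpoly L[3]}) : seq (L * L) :=
  [:: (cf f 1 1 1 * cf f 0 0 3, cf f 0 1 2 * cf f 1 0 2);
      (cf f 1 1 1 * cf f 0 3 0, cf f 0 2 1 * cf f 1 2 0);
      (cf f 1 1 1 * cf f 3 0 0, cf f 2 0 1 * cf f 2 1 0)].

Definition same_positive_valuation (R : realType) (w : valuation R L)
    (s : seq (L * L)) : Prop :=
  exists2 e : \bar R, (0 < e)%E &
    forall q, q \in s -> q.2 != 0 /\ w (q.1 / q.2) = e.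

Definition symmetric_honeycomb_form (R : realType) (w : valuation R L)
    (f : {mpoly L[3]}) : Prop :=
  same_positive_valuation w (honeycombA f) /\
  same_positive_valuation w (honeycombB f).

(* Smoothness of V(f) in the projective plane; meaningful when L is
   algebraically closed, as only L-rational points are tested. *)
Definition nonsingular (f : {mpoly L[3]}) : Prop :=
  forall p : 'I_3 -> L, (exists i, p i != 0) -> f.@[p] = 0 ->
    exists i, (f^`M(i)).@[p] != 0.

Definition linear_subst (M : 'M[L]_3) (f : {mpoly L[3]}) : {mpoly L[3]} :=
  f \mPo [tuple \sum_(j < 3) M i j *: 'X_j | i < 3].

Record weierstrass := Weierstrass { a1 : L; a2 : L; a3 : L; a4 : L; a6 : L }.

Definition weierstrass_cubic (W : weierstrass) : {mpoly L[3]} :=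
  Y ^+ 2 * Z + a1 W *: (X * Y * Z) + a3 W *: (Y * Z ^+ 2)
  - (X ^+ 3 + a2 W *: (X ^+ 2 * Z) + a4 W *: (X * Z ^+ 2) + a6 W *: Z ^+ 3).

Definition b2 W := a1 W ^+ 2 + 4 * a2 W.
Definition b4 W := 2 * a4 W + a1 W * a3 W.
Definition b6 W := a3 W ^+ 2 + 4 * a6 W.
Definition b8 W := a1 W ^+ 2 * a6 W + 4 * a2 W * a6 W - a1 W * a3 W * a4 W
                   + a2 W * a3 W ^+ 2 - a4 W ^+ 2.
Definition c4 W := b2 W ^+ 2 - 24 * b4 W.
Definition weierstrass_disc W :=
  - (b2 W ^+ 2 * b8 W) - 8 * b4 W ^+ 3 - 27 * b6 W ^+ 2
  + 9 * b2 W * b4 W * b6 W.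
Definition weierstrass_j W := c4 W ^+ 3 / weierstrass_disc W.

End TernaryCubics.

(* j(f) is the j-invariant of a Weierstrass model of the elliptic curve V(f).
   Over an algebraically closed field a nonsingular plane cubic is brought into
   Weierstrass form by a linear change of coordinates (moving a flex and its
   tangent line), and the resulting value of c4^3 / disc is independent of all
   choices; hence for nonsingular f exactly one j satisfies this relation. *)
Definition has_j_invariant (L : closedFieldType) (f : {mpoly L[3]}) (j : L) :
    Prop :=
  exists (M : 'M[L]_3) (c : L) (W : weierstrass L),
    [/\ M \in unitmx, c != 0, linear_subst M f = c *: weierstrass_cubic W,
        weierstrass_disc W != 0 & j = weierstrass_j W].

(* Main.v *)
Require Import Defs.
From mathcomp Require Import all_boot all_order all_algebra mpoly.
From mathcomp Require Import reals constructive_ereal.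
From mathcomp Require Import ring_quotient ring lra.

(** Write l = b - 3a, m = 1 + 3a - 3b, N = 3l + m = 1 - 6a and u = x + y + z.
The line u = 0 meets the symmetric cubic g in three flexes, whose tangents are
the lines t_x = l u + m x, t_y = l u + m y and t_z = l u + m z.  A symmetric
cubic is determined by three coefficients, and comparing them gives

    m^2 g = t_x t_y t_z + E u^3,
    E = 2 b^3 - (1 + 3a) b^2 + a (1 - 3a + 9a^2).

Since t_x + t_y + t_z = N u, this is a Weierstrass model with a 3-torsion
point: a1 = -N, a3 = E and a2 = a4 = a6 = 0 ([flex_substE]).  Hence
disc = - E^3 (N^3 + 27 E), c4 = N (N^3 + 24 E), and j(g) = iota amounts to

    N^3 (N^3 + 24 E)^3 + iota E^3 (N^3 + 27 E) = 0,        ([j_equation])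

of degree 4 in E and of degree 12 in b.  The honeycomb conditions reduce to
b <> 0, val(b) > 0 and val(a / b^2) > 0.

The six solutions are exactly the roots b of this equation with val(b) > 0.
For such a root N and N^3 + c E are units for every integral c, so that
val(E) = - val(iota) / 3 < val(a).  As E = a * unit - b^2 * unit, this forces
2 val(b) = val(E) < val(a), which is the honeycomb condition.  Their number,
with multiplicity, is read off the equation divided by iota: modulo the maximal
ideal it is E^3 (N^3 + 27 E), whose order of vanishing at b = 0 is 3 * 2
([order_at_j_equation], [order_at_count]).  They are simple roots by the chain
rule and another comparison of valuations ([j_equation_simple]).

To see that a solution of the geometric problem is a root of the equation, the
j-invariant must not depend on the Weierstrass model.  This is deduced from
the covariance of the Hessian under linear substitutions: on the pencil spanned
by y^2 z - x^3 - A x z^2 - B z^3 and its Hessian, the Hessian is given by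
explicit polynomials in A and B, so a linear equivalence of two short
Weierstrass cubics multiplies A and B by the fourth and the sixth power of the
same scalar ([short_weierstrass_equiv], [weierstrass_j_unique]). *)

Set Implicit Arguments.
Unset Strict Implicit.
Unset Printing Implicit Defensive.
Import Order.TTheory GRing.Theory Num.Theory.

Local Open Scope ring_scope.

Local Notation i0 := (@Ordinal 3 0 isT).
Local Notation i1 := (@Ordinal 3 1 isT).
Local Notation i2 := (@Ordinal 3 2 isT).

(** * Ternary cubic forms and their Hessians *)

(** Every integer that has to be inverted below is of this form. *)
Lemma natr_pow2_pow3_neq0 (F : fieldType) (i j : nat) :
  2 != 0 :> F -> 3 != 0 :> F -> (2 ^ i * 3 ^ j)%:R != 0 :> F.
Proof. by move=> n2 n3; rewrite natrM !natrX mulf_neq0 ?expf_neq0. Qed.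

(** Reduces the derivation of an equation from others to a ring identity that
exhibits it as a combination of them. *)
Lemma eq_by_combination (V : zmodType) (l r x y : V) :
  l = r -> x - y = l - r -> x = y.
Proof. by move=> -> /eqP; rewrite subrr subr_eq0 => /eqP. Qed.

Lemma sum3 (V : nmodType) (F : 'I_3 -> V) : \sum_i F i = F i0 + F i1 + F i2.
Proof.
rewrite !big_ord_recl big_ord0 addr0 addrA.
by congr (F _ + F _ + F _); apply: val_inj.
Qed.

Lemma det3 (R : comNzRingType) (G : 'M[R]_3) : \det G =
  G i0 i0 * (G i1 i1 * G i2 i2 - G i1 i2 * G i2 i1)
  - G i0 i1 * (G i1 i0 * G i2 i2 - G i1 i2 * G i2 i0)
  + G i0 i2 * (G i1 i0 * G i2 i1 - G i1 i1 * G i2 i0).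
Proof.
(* Indexing by nat lets the lifted ordinals of the Laplace expansion compute. *)
pose g (i j : nat) := G (inord i) (inord j).
have gE (i j : 'I_3) : G i j = g i j by rewrite /g !inord_val.
rewrite (expand_det_row _ i0) sum3 /cofactor !(expand_det_row _ ord0).
rewrite !big_ord_recl !big_ord0 /cofactor !det_mx11 !mxE !gE /= /bump /=.
by ring.
Qed.

Section TernaryForms.
Context (L : fieldType).
Implicit Types (u v w : 'cV[L]_3) (A B s : L).

Record ternary_form := TernaryForm {
  k300 : L; k210 : L; k120 : L; k030 : L; k021 : L;
  k012 : L; k003 : L; k102 : L; k201 : L; k111 : L }.

Implicit Types q : ternary_form.

Definition form_eval q v : L :=
  let x := v i0 0 in let y := v i1 0 in let z := v i2 0 in
  k300 q * x ^+ 3 + k210 q * (x ^+ 2 * y) + k120 q * (x * y ^+ 2)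
  + k030 q * y ^+ 3 + k021 q * (y ^+ 2 * z) + k012 q * (y * z ^+ 2)
  + k003 q * z ^+ 3 + k102 q * (x * z ^+ 2) + k201 q * (x ^+ 2 * z)
  + k111 q * (x * y * z).

Definition scale_form (k : L) q :=
  TernaryForm (k * k300 q) (k * k210 q) (k * k120 q) (k * k030 q) (k * k021 q)
       (k * k012 q) (k * k003 q) (k * k102 q) (k * k201 q) (k * k111 q).

(** The third difference of a function at the origin: for a cubic form it is
six times the associated symmetric trilinear form. *)
Definition polar (f : 'cV[L]_3 -> L) u v w : L :=
  f (u + v + w) - f (u + v) - f (u + w) - f (v + w) + f u + f v + f w.

Definition hessian_entry q v (i j : nat) : L :=
  let x := v i0 0 in let y := v i1 0 in let z := v i2 0 in
  match i, j with
  | 0%N, 0%N => 6 * k300 q * x + 2 * k210 q * y + 2 * k201 q * z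
  | 1%N, 1%N => 2 * k120 q * x + 6 * k030 q * y + 2 * k021 q * z
  | 2%N, 2%N => 2 * k102 q * x + 2 * k012 q * y + 6 * k003 q * z
  | 0%N, 1%N | 1%N, 0%N => 2 * k210 q * x + 2 * k120 q * y + k111 q * z
  | 0%N, 2%N | 2%N, 0%N => 2 * k201 q * x + k111 q * y + 2 * k102 q * z
  | _, _ => k111 q * x + 2 * k021 q * y + 2 * k012 q * z
  end.

Definition hessian_mx q v : 'M[L]_3 := \matrix_(i, j) hessian_entry q v i j.

Lemma polar_hessian q u v w :
  polar (form_eval q) u v w = (u^T *m hessian_mx q w *m v) 0 0.
Proof.
rewrite !mxE sum3 !mxE !sum3 !mxE /polar /form_eval !mxE /=.
by ring.
Qed.

(** Polarization involves the values of the form only, so it commutes with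
substitutions; this replaces the chain rule for second derivatives. *)
Lemma hessian_mx_subst q q' (M : 'M[L]_3) w :
  (forall v, form_eval q (M *m v) = form_eval q' v) ->
  hessian_mx q' w = M^T *m hessian_mx q (M *m w) *m M.
Proof.
move=> qM.
have polarM u v : polar (form_eval q) (M *m u) (M *m v) (M *m w)
                  = polar (form_eval q') u v w.
  by rewrite /polar -!mulmxDr !qM.
apply/matrixP => i j.
have := polarM (delta_mx i 0) (delta_mx j 0); rewrite !polar_hessian.
rewrite trmx_mul trmx_delta !mulmxA -(mulmxA _ M^T) -(mulmxA _ _ M).
rewrite -!rowE -!colE.
have entryE (G : 'M[L]_3) : col j (row i G) 0 0 = G i j by rewrite !mxE.
by rewrite !entryE.
Qed.

Lemma det_hessian_subst q q' (M : 'M[L]_3) w :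
  (forall v, form_eval q (M *m v) = form_eval q' v) ->
  \det (hessian_mx q' w) = \det M ^+ 2 * \det (hessian_mx q (M *m w)).
Proof. by move=> /hessian_mx_subst ->; rewrite !det_mulmx det_tr; ring. Qed.

Lemma form_eval_scale k q v : form_eval (scale_form k q) v = k * form_eval q v.
Proof. by rewrite /form_eval /=; ring. Qed.

Lemma det_hessian_scale k q v :
  \det (hessian_mx (scale_form k q) v) = k ^+ 3 * \det (hessian_mx q v).
Proof. by rewrite !det3 !mxE /hessian_entry /=; ring. Qed.

(** The short Weierstrass cubic y^2 z - x^3 - A x z^2 - B z^3 plus s times
[hessian_eighth A B]. *)
Definition hessian_pencil A B s : ternary_form :=
  TernaryForm (-1) 0 (3 * s) 0 1 0 (- B - A ^+ 2 * s) (- A + 9 * B * s)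
    (3 * A * s) 0.

(** One eighth of the Hessian determinant of the short Weierstrass cubic, as
[det_hessian_pencil] shows at s = 0. *)
Definition hessian_eighth A B : ternary_form :=
  TernaryForm 0 0 3 0 0 0 (- A ^+ 2) (9 * B) (3 * A) 0.

Lemma form_eval_pencil A B s v : form_eval (hessian_pencil A B s) v =
  form_eval (hessian_pencil A B 0) v + s * form_eval (hessian_eighth A B) v.
Proof. by rewrite /form_eval /=; ring. Qed.

(** The Hessian maps the pencil to itself, and the coefficients that describe
this map carry the invariants A and B. *)
Lemma det_hessian_pencil A B s v :
  \det (hessian_mx (hessian_pencil A B s) v) =
  (- 72 * A * s + 648 * B * s ^+ 2 + 216 * A ^+ 2 * s ^+ 3)
    * form_eval (hessian_pencil A B 0) v
  + 8 * (1 + 9 * A * s ^+ 2 - 27 * B * s ^+ 3)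
    * form_eval (hessian_eighth A B) v.
Proof. by rewrite det3 !mxE /hessian_entry /form_eval /=; ring. Qed.

(** With d = det M, covariance of the Hessian matches the member of parameter
t c^2 of the pencil of (A', B') with that of parameter t d^2 for (A, B).
Comparing the Hessians of these two members, for several values of t, yields
both equations. *)
Lemma short_weierstrass_equiv A B A' B' (c : L) (M : 'M[L]_3) :
  2 != 0 :> L -> 3 != 0 :> L -> c != 0 ->
  (forall v, form_eval (hessian_pencil A B 0) (M *m v) =
             c * form_eval (hessian_pencil A' B' 0) v) ->
  c ^+ 4 * A' = \det M ^+ 4 * A /\ c ^+ 6 * B' = \det M ^+ 6 * B.
Proof.
move=> n2 n3 c0 fM; set d := \det M.
have n8 : 8 != 0 :> L := natr_pow2_pow3_neq0 3 0 n2 n3.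
have hM v : d ^+ 2 * form_eval (hessian_eighth A B) (M *m v) =
            c ^+ 3 * form_eval (hessian_eighth A' B') v.
  have f'M u : form_eval (hessian_pencil A B 0) (M *m u) =
               form_eval (scale_form c (hessian_pencil A' B' 0)) u.
    by rewrite form_eval_scale.
  have := det_hessian_subst v f'M.
  rewrite det_hessian_scale !det_hessian_pencil -/d => E.
  by apply: (mulfI n8); apply: (eq_by_combination (esym E)); ring.
have key t : t != 0 ->
  (d ^+ 4 * A - c ^+ 4 * A') + 9 * (c ^+ 6 * B' - d ^+ 6 * B) * t
   + 3 * (c ^+ 8 * A' ^+ 2 - d ^+ 8 * A ^+ 2) * t ^+ 2 = 0.
  move=> t0.
  have pM u : form_eval (hessian_pencil A B (t * d ^+ 2)) (M *m u) =
      form_eval (scale_form c (hessian_pencil A' B' (t * c ^+ 2))) u.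
    rewrite form_eval_scale !(form_eval_pencil _ _ (_ * _)) fM -mulrA hM.
    by ring.
  (* At (1 : 0 : 0) the Hessian of the cubic vanishes but the cubic does not. *)
  have := det_hessian_subst (delta_mx i0 0) pM.
  rewrite det_hessian_scale !det_hessian_pencil fM -/d.
  set h := form_eval (hessian_eighth A B) (M *m _).
  have h0 : d ^+ 2 * h = 0.
    by rewrite /h hM /form_eval !mxE /=; ring.
  have -> : form_eval (hessian_eighth A' B') (delta_mx i0 0) = 0.
    by rewrite /form_eval !mxE /=; ring.
  have -> : form_eval (hessian_pencil A' B' 0) (delta_mx i0 0) = -1.
    by rewrite /form_eval !mxE /=; ring.
  rewrite [X in _ = X]mulrDr [d ^+ 2 * (_ * h)]mulrCA h0 => E.
  have n72 : c * 72 * t != 0.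
    by rewrite !mulf_neq0 //; exact: (natr_pow2_pow3_neq0 3 2).
  by apply: (mulfI n72); apply: (eq_by_combination (esym E)); ring.
have nN1 : -1 != 0 :> L by rewrite oppr_eq0 oner_neq0.
have e1 := key 1 (oner_neq0 _); have eN1 := key (-1) nN1; have e2 := key 2 n2.
have n18 : 18 != 0 :> L := natr_pow2_pow3_neq0 1 2 n2 n3.
have EB : c ^+ 6 * B' = d ^+ 6 * B.
  apply: (mulfI n18).
  by apply: (eq_by_combination (congr2 (fun x y => x - y) e1 eN1)); ring.
have EA2 : c ^+ 8 * A' ^+ 2 = d ^+ 8 * A ^+ 2.
  apply: (mulfI n18).
  by apply: (eq_by_combination (congr2 (fun x y => x + y)
    (congr2 (fun x y => 2 * x - 3 * y) e2 e1) eN1)); ring.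
split=> //.
by apply: (eq_by_combination (congr2 (fun x y => x + y)
  (congr2 (fun x y => 9 * x + 3 * y) EB EA2) (congr1 -%R e1))); ring.
Qed.

End TernaryForms.

(** * Independence of the j-invariant from the Weierstrass model *)

Section Weierstrass.
Context (L : fieldType).
Implicit Types (v : 'cV[L]_3) (W : weierstrass L) (f : {mpoly L[3]}).

Definition weierstrass_form W : ternary_form L :=
  TernaryForm (-1) 0 0 0 1 (a3 W) (- a6 W) (- a4 W) (- a2 W) (a1 W).

Lemma meval_weierstrass W v :
  (weierstrass_cubic W).@[fun i => v i 0] = form_eval (weierstrass_form W) v.
Proof.
rewrite /weierstrass_cubic !(mevalB, mevalD, mevalM, mevalZ, rmorphXn) /=.
by rewrite !mevalXU /form_eval /=; ring.
Qed.

Lemma meval_linear_subst (M : 'M[L]_3) f v :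
  (linear_subst M f).@[fun i => v i 0] = f.@[fun i => (M *m v) i 0].
Proof.
rewrite /linear_subst comp_mpoly_meval; apply: meval_eq => i.
rewrite tnth_mktuple raddf_sum mxE; apply: eq_bigr => j _.
by rewrite -[LHS]/(meval _ _) mevalZ mevalXU.
Qed.

(** The usual - c4 / 48 and - c6 / 864. *)
Definition short_a4 W := - c4 W / 48.
Definition short_a6 W := (b2 W ^+ 3 - 36 * b2 W * b4 W + 216 * b6 W) / 864.

(** Completes the square in y and the cube in x. *)
Definition to_short W : 'M[L]_3 :=
  \matrix_(i, j) match val i, val j with
  | 0%N, 2%N => b2 W / 12
  | 1%N, 0%N => a1 W / 2
  | 1%N, 2%N => a3 W / 2
  | _, _ => (i == j)%:R
  end.

Lemma det_to_short W : \det (to_short W) = 1.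
Proof. by rewrite det3 !mxE /=; ring. Qed.

Lemma weierstrass_to_short W v : 2 != 0 :> L -> 3 != 0 :> L ->
  form_eval (weierstrass_form W) v
  = form_eval (hessian_pencil (short_a4 W) (short_a6 W) 0) (to_short W *m v).
Proof.
move=> n2 n3; rewrite /form_eval !mxE !sum3 !mxE /=.
rewrite /short_a4 /short_a6 /c4 /b2 /b4 /b6; field.
by rewrite n2 (natr_pow2_pow3_neq0 2 1) ?(natr_pow2_pow3_neq0 4 1)
  ?(natr_pow2_pow3_neq0 5 3).
Qed.

Lemma c4_short W : 2 != 0 :> L -> 3 != 0 :> L -> c4 W = - 48 * short_a4 W.
Proof.
by move=> n2 n3; rewrite /short_a4; field; exact: (natr_pow2_pow3_neq0 4 1).
Qed.

Lemma disc_short W : 2 != 0 :> L -> 3 != 0 :> L -> weierstrass_disc W =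
  - 16 * (4 * short_a4 W ^+ 3 + 27 * short_a6 W ^+ 2).
Proof.
move=> n2 n3.
rewrite /weierstrass_disc /short_a4 /short_a6 /c4 /b2 /b4 /b6 /b8; field.
by rewrite (natr_pow2_pow3_neq0 4 1) ?(natr_pow2_pow3_neq0 5 3).
Qed.

(** Passing to short forms on both sides, the previous section provides a scalar
e such that c4 and disc of the two models differ by the factors e^4 and e^12. *)
Lemma weierstrass_j_unique f (M M' : 'M[L]_3) (c c' : L) W W' :
  2 != 0 :> L -> 3 != 0 :> L ->
  M \in unitmx -> c != 0 -> linear_subst M f = c *: weierstrass_cubic W ->
  M' \in unitmx -> c' != 0 -> linear_subst M' f = c' *: weierstrass_cubic W' ->
  weierstrass_disc W' != 0 ->
  weierstrass_disc W != 0 /\ weierstrass_j W = weierstrass_j W'.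
Proof.
move=> n2 n3 uM c0 fM uM' c'0 fM' disc'0.
have evalM v :
    f.@[fun i => (M *m v) i 0] = c * form_eval (weierstrass_form W) v.
  by rewrite -meval_linear_subst fM mevalZ meval_weierstrass.
have evalM' v :
    f.@[fun i => (M' *m v) i 0] = c' * form_eval (weierstrass_form W') v.
  by rewrite -meval_linear_subst fM' mevalZ meval_weierstrass.
have uN : to_short W' \in unitmx by rewrite unitmxE det_to_short unitr1.
pose T := to_short W *m invmx M *m M' *m invmx (to_short W').
have dT : \det T != 0.
  rewrite -unitfE -unitmxE !unitmx_mul !unitmx_inv uM uM' uN !andbT.
  by rewrite unitmxE det_to_short unitr1.
pose k := c' / c; have k0 : k != 0 by rewrite mulf_neq0 ?invr_eq0.
have eqT v : form_eval (hessian_pencil (short_a4 W) (short_a6 W) 0) (T *m v)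
      = k * form_eval (hessian_pencil (short_a4 W') (short_a6 W') 0) v.
  rewrite -[v in RHS](mulKVmx uN) -weierstrass_to_short // /T -!mulmxA.
  rewrite -weierstrass_to_short //; apply: (mulfI c0).
  by rewrite -evalM (mulKVmx uM) evalM' /k mulrA mulrCA divff ?mulr1.
have [e4 e6] := short_weierstrass_equiv n2 n3 k0 eqT.
set d := \det T in dT e4 e6.
have kd0 : (k ^+ 12 != 0) * (d ^+ 12 != 0) by rewrite !expf_neq0.
have eD : k ^+ 12 * weierstrass_disc W' = d ^+ 12 * weierstrass_disc W.
  rewrite !disc_short //.
  transitivity (-16 * (4 * (k ^+ 4 * short_a4 W') ^+ 3
                       + 27 * (k ^+ 6 * short_a6 W') ^+ 2)); first by ring.
  by rewrite e4 e6; ring.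
have ec4 : k ^+ 12 * c4 W' ^+ 3 = d ^+ 12 * c4 W ^+ 3.
  rewrite !c4_short //.
  transitivity (- 48 ^+ 3 * (k ^+ 4 * short_a4 W') ^+ 3); first by ring.
  by rewrite e4; ring.
have disc0 : weierstrass_disc W != 0.
  have : d ^+ 12 * weierstrass_disc W != 0 by rewrite -eD mulf_neq0 ?kd0.
  by rewrite mulf_eq0 negb_or => /andP[].
split=> //; rewrite /weierstrass_j.
apply/eqP; rewrite eqr_div //; apply/eqP/(mulfI kd0.1).
by rewrite mulrCA eD mulrA [c4 W ^+ 3 * _]mulrC -ec4 -mulrA.
Qed.

End Weierstrass.

Lemma has_j_invariantE (L : closedFieldType) (f : {mpoly L[3]}) (M : 'M[L]_3)
    (c : L) (W : weierstrass L) (j : L) : 2 != 0 :> L -> 3 != 0 :> L ->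
  M \in unitmx -> c != 0 -> linear_subst M f = c *: weierstrass_cubic W ->
  has_j_invariant f j <-> weierstrass_disc W != 0 /\ j = weierstrass_j W.
Proof.
move=> n2 n3 uM c0 fM; split=> [[M' [c' [W' [uM' c'0 fM' disc'0 ->]]]]|[d0 ->]].
  by have [] := weierstrass_j_unique n2 n3 uM c0 fM uM' c'0 fM' disc'0.
by exists M, c, W; split.
Qed.

(** * Geometry of the symmetric cubic *)

(** The coefficient E of m^2 g = t_x t_y t_z + E u^3.  It equals
a m^2 - l^2 (l + m), by comparing the coefficients of u^3. *)
Definition flex_coef (R : comNzRingType) (a b : R) : R :=
  2 * b ^+ 3 - (1 + 3 * a) * b ^+ 2 + a * (1 - 3 * a + 9 * a ^+ 2).

(** c4^3 - iota * disc for the Weierstrass model [flex_model].  The ring is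
arbitrary so that b may be a scalar or the polynomial variable. *)
Definition j_equation (R : comNzRingType) (iota a b : R) : R :=
  let N := 1 - 6 * a in let E := flex_coef a b in
  N ^+ 3 * (N ^+ 3 + 24 * E) ^+ 3 + iota * (E ^+ 3 * (N ^+ 3 + 27 * E)).

Section SymmetricCubic.
Context (L : fieldType) (a b : L).

Local Notation l := (b - 3 * a).
Local Notation m := (1 + 3 * a - 3 * b).
Local Notation N := (1 - 6 * a).
Local Notation E := (flex_coef a b).

Definition flex_model := Weierstrass (- N) 0 E 0 0.

(** Inverse, up to the factor m, of the change of coordinates
X = u, Y = t_x, Z = t_y / E, which puts the flex (0 : 1 : -1) of g, with
tangent t_x = 0, at (0 : 0 : 1). *)
Definition flex_subst : 'M[L]_3 :=
  \matrix_(i, j) match val i, val j with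
  | 0%N, 0%N | 1%N, 0%N => - l
  | 0%N, 1%N => 1
  | 1%N, 2%N => E
  | 2%N, 0%N => m + 2 * l
  | 2%N, 1%N => - 1
  | 2%N, 2%N => - E
  | _, _ => 0
  end.

Lemma det_flex_subst : \det flex_subst = m * E.
Proof. by rewrite det3 !mxE /=; ring. Qed.

Lemma linear_substXU (M : 'M[L]_3) (i : 'I_3) :
  'X_i \mPo [tuple \sum_(j < 3) M i j *: 'X_j | i < 3] =
  (M i i0)%:MP * 'X_i0 + (M i i1)%:MP * 'X_i1 + (M i i2)%:MP * 'X_i2
  :> {mpoly L[3]}.
Proof. by rewrite comp_mpolyXU -tnth_nth tnth_mktuple sum3 !mul_mpolyC. Qed.

Lemma flex_substE :
  linear_subst flex_subst (symmetric_cubic a b) =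
  - (m * E) *: weierstrass_cubic flex_model.
Proof.
rewrite /linear_subst /symmetric_cubic /weierstrass_cubic /=.
rewrite !(comp_mpolyD, comp_mpolyZ, rmorphM, rmorphXn) /=.
rewrite !linear_substXU !mxE /= -!mul_mpolyC /flex_coef.
by ring.
Qed.

Lemma mderivXU (i j : 'I_3) : 'X_i^`M(j) = (i == j)%:R :> {mpoly L[3]}.
Proof.
rewrite mderivX mnm1E; case: eqP => [->|_]; last by rewrite scale0r.
by rewrite -[X in (X - _)%MM]add0m addmK mpolyX0 scale1r.
Qed.

Lemma symmetric_cubic_mderiv (p : 'I_3 -> L) (i j k : 'I_3) :
  uniq [:: i; j; k] ->
  ((symmetric_cubic a b)^`M(i)).@[p] =
  3 * a * p i ^+ 2 + b * (2 * p i * (p j + p k) + p j ^+ 2 + p k ^+ 2)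
  + p j * p k.
Proof.
rewrite /symmetric_cubic !exprS !expr0 !mulr1.
rewrite !(mderivD, mderivZ, mderivM) !mderivXU.
have iE (n : 'I_3) : [\/ n = i0, n = i1 | n = i2].
  by case: n => -[|[|[|//]]] ?;
    [constructor 1|constructor 2|constructor 3]; apply: val_inj.
by case: (iE i) => ->; case: (iE j) => ->; case: (iE k) => -> //= _;
   rewrite !(mevalD, mevalZ, mevalM, mevalXU, meval1, meval0); ring.
Qed.

(** In the coordinates t_x, t_y, t_z, u the partial derivatives of
t_x t_y t_z + E u^3 show that a singular point either lies on two of the lines
and on u = 0, which is impossible, or has t_x = t_y = t_z; it is then
(1 : 1 : 1), where the vanishing of g amounts to N^3 + 27 E = 0. *)
Lemma symmetric_cubic_nonsingular : 3 != 0 :> L -> m != 0 -> E != 0 ->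
  N ^+ 3 + 27 * E != 0 -> nonsingular (symmetric_cubic a b).
Proof.
move=> n3 m0 E0 F0 p [i pi0] _.
apply/existsP; apply: contraNT pi0; rewrite negb_exists => /forallP dp.
have {}dp j : ((symmetric_cubic a b)^`M(j)).@[p] = 0.
  by apply/eqP; rewrite -[_ == _]negbK dp.
have := dp i0; have := dp i1; have := dp i2.
rewrite (@symmetric_cubic_mderiv _ i2 i0 i1) //.
rewrite (@symmetric_cubic_mderiv _ i1 i0 i2) //.
rewrite (@symmetric_cubic_mderiv _ i0 i1 i2) //.
set x := p i0; set y := p i1; set z := p i2 => gz gy gx.
suff [x0 y0 z0] : [/\ x = 0, y = 0 & z = 0].
  by case: i => -[|[|[|//]]] lt_i; apply/eqP;
     [rewrite -x0|rewrite -y0|rewrite -z0]; congr p; apply: val_inj.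
pose u := x + y + z.
pose tx := l * u + m * x; pose ty := l * u + m * y; pose tz := l * u + m * z.
have hx : ty * (tz - tx) = 0.
  apply: (mulfI m0).
  apply: (eq_by_combination (congr2 (fun g h => m ^+ 2 * (g - h)) gx gz)).
  by rewrite /ty /tz /tx /u /flex_coef; ring.
have hy : tx * (tz - ty) = 0.
  apply: (mulfI m0).
  apply: (eq_by_combination (congr2 (fun g h => m ^+ 2 * (g - h)) gy gz)).
  by rewrite /ty /tz /tx /u /flex_coef; ring.
have hz : l * (ty * tz + tx * tz) + (l + m) * (tx * ty) + 3 * E * u ^+ 2 = 0.
  apply: (eq_by_combination (congr1 (fun g => m ^+ 2 * g) gz)).
  by rewrite /ty /tz /tx /u /flex_coef; ring.
have u_eq0 : tx * tz = 0 -> ty * tz = 0 -> tx * ty = 0 -> u = 0.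
  move=> h1 h2 h3; move: hz; rewrite h1 h2 h3 !(addr0, mulr0, add0r).
  move/eqP; rewrite -mulrA !mulf_eq0 (negPf n3) (negPf E0) /= orbb.
  by move/eqP.
have t_eq0 c : u = 0 -> (l * u + m * c == 0) = (c == 0).
  by move=> ->; rewrite mulr0 add0r mulf_eq0 (negPf m0).
have [tx0|tx0] := eqVneq tx 0.
  move: hx; rewrite tx0 subr0 => tyz.
  have u0 : u = 0 by apply: u_eq0; rewrite ?tx0 ?mul0r.
  have /eqP x0 : x == 0 by rewrite -(t_eq0 _ u0) -/tx tx0.
  move: u0; rewrite /u x0 add0r => u0.
  move/eqP: tyz; rewrite mulf_eq0 !t_eq0 ?/u ?x0 ?add0r // => /orP[]/eqP e0;
  by move: u0; rewrite e0 ?add0r ?addr0.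
have [ty0|ty0] := eqVneq ty 0.
  move: hy; rewrite ty0 subr0 => txz.
  have u0 : u = 0 by apply: u_eq0; rewrite ?ty0 ?mul0r ?mulr0.
  have /eqP y0 : y == 0 by rewrite -(t_eq0 _ u0) -/ty ty0.
  move/eqP: txz; rewrite mulf_eq0 !t_eq0 // => /orP[]/eqP e0; move: u0;
  by rewrite /u e0 y0 ?(add0r, addr0).
have zx : z = x.
  move/eqP: hx; rewrite mulf_eq0 (negPf ty0) /=.
  rewrite (_ : tz - tx = m * (z - x)); last by rewrite /tz /tx; ring.
  by rewrite mulf_eq0 (negPf m0) subr_eq0 => /eqP.
have zy : z = y.
  move/eqP: hy; rewrite mulf_eq0 (negPf tx0) /=.
  rewrite (_ : tz - ty = m * (z - y)); last by rewrite /tz /ty; ring.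
  by rewrite mulf_eq0 (negPf m0) subr_eq0 => /eqP.
have /eqP : (N ^+ 3 + 27 * E) * x ^+ 2 = 0.
  by rewrite -hz /tx /ty /tz /u -zy zx; ring.
rewrite mulf_eq0 (negPf F0) expf_eq0 /= => /eqP x0.
by rewrite -zy zx x0.
Qed.

Lemma symmetric_cubic_cf (i j k : nat) : (i + j + k)%N = 3%N ->
  cf (symmetric_cubic a b) i j k =
  if [|| i == 3, j == 3 | k == 3]%N then a else
  if [&& i == 1, j == 1 & k == 1]%N then 1 else b.
Proof.
have mX (e0 e1 e2 : nat) : 'X_i0 ^+ e0 * 'X_i1 ^+ e1 * 'X_i2 ^+ e2
     = 'X_[[multinom [tuple e0; e1; e2]]] :> {mpoly L[3]}.
  rewrite [RHS]mpolyXE_id !big_ord_recl big_ord0 mulr1 !multinomE mulrA /=.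
  have -> : lift ord0 ord0 = i1 :> 'I_3 by apply: val_inj.
  have -> : lift ord0 (lift ord0 ord0) = i2 :> 'I_3 by apply: val_inj.
  by rewrite (_ : ord0 = i0) //; apply: val_inj.
have eqm (e0 e1 e2 : nat) :
    ([multinom [tuple e0; e1; e2]] == [multinom [tuple i; j; k]])
    = [&& e0 == i, e1 == j & e2 == k].
  by rewrite -val_eqE -val_eqE /= !eqseq_cons andbT.
have -> : symmetric_cubic a b =
  a *: ('X_i0 ^+ 3 * 'X_i1 ^+ 0 * 'X_i2 ^+ 0
        + 'X_i0 ^+ 0 * 'X_i1 ^+ 3 * 'X_i2 ^+ 0
        + 'X_i0 ^+ 0 * 'X_i1 ^+ 0 * 'X_i2 ^+ 3)
  + b *: ('X_i0 ^+ 2 * 'X_i1 ^+ 1 * 'X_i2 ^+ 0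
          + 'X_i0 ^+ 2 * 'X_i1 ^+ 0 * 'X_i2 ^+ 1
          + 'X_i0 ^+ 1 * 'X_i1 ^+ 2 * 'X_i2 ^+ 0
          + 'X_i0 ^+ 1 * 'X_i1 ^+ 0 * 'X_i2 ^+ 2
          + 'X_i0 ^+ 0 * 'X_i1 ^+ 2 * 'X_i2 ^+ 1
          + 'X_i0 ^+ 0 * 'X_i1 ^+ 1 * 'X_i2 ^+ 2)
  + 'X_i0 ^+ 1 * 'X_i1 ^+ 1 * 'X_i2 ^+ 1.
  by rewrite /symmetric_cubic !expr0 !(mulr1, mul1r, expr1).
rewrite !mX /cf !(mcoeffD, mcoeffZ, mcoeffX) !eqm; move=> {eqm mX}.
case: i => [|[|[|[|//]]]]; case: j => [|[|[|[|//]]]];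
  case: k => [|[|[|[|//]]]] //= _;
by rewrite ?(mulr0, addr0, add0r, mulr1).
Qed.

(** All six scalars of type (A) equal b, and all three of type (B) equal
a / b^2. *)
Lemma symmetric_honeycomb_formE (R : realType) (w : valuation R L) :
  symmetric_honeycomb_form w (symmetric_cubic a b) <->
  [/\ b != 0, (0 < w b)%E & (0 < w (a / b ^+ 2)%R)%E].
Proof.
rewrite /symmetric_honeycomb_form /honeycombA /honeycombB.
rewrite !symmetric_cubic_cf //=.
split=> [[[e e_gt0 hA] [e' e'_gt0 hB]]|[b0 wb wab]].
  have [bb wb] := hA _ (mem_head _ _); have [_ wab] := hB _ (mem_head _ _).
  have b0 : b != 0 by move: bb; rewrite /= mul1r.
  split=> //; first by rewrite -(mulfK b0 b) -[X in _ / X]mul1r wb.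
  by rewrite expr2 -[X in X / _]mul1r wab.
split; [exists (w b) => // q|exists (w (a / b ^+ 2)) => // q].
  by rewrite !inE !orbb => /eqP -> /=; rewrite mul1r mulfK.
by rewrite !inE !orbb => /eqP -> /=; rewrite mul1r mulf_neq0.
Qed.

Lemma weierstrass_disc_flex_model :
  weierstrass_disc flex_model = - (E ^+ 3 * (N ^+ 3 + 27 * E)).
Proof. by rewrite /weierstrass_disc /b2 /b4 /b6 /b8 /=; ring. Qed.

Lemma c4_flex_model : c4 flex_model = N * (N ^+ 3 + 24 * E).
Proof. by rewrite /c4 /b2 /b4 /=; ring. Qed.

End SymmetricCubic.

Lemma has_j_invariant_symmetric (L : closedFieldType) (iota a b : L) :
  2 != 0 :> L -> 3 != 0 :> L -> 1 + 3 * a - 3 * b != 0 ->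
  flex_coef a b != 0 -> (1 - 6 * a) ^+ 3 + 27 * flex_coef a b != 0 ->
  has_j_invariant (symmetric_cubic a b) iota <-> j_equation iota a b = 0.
Proof.
move=> n2 n3 m0 E0 F0.
have uM : flex_subst a b \in unitmx.
  by rewrite unitmxE unitfE det_flex_subst mulf_neq0.
have c0 : - ((1 + 3 * a - 3 * b) * flex_coef a b) != 0.
  by rewrite oppr_eq0 mulf_neq0.
have D0 : weierstrass_disc (flex_model a b) != 0.
  by rewrite weierstrass_disc_flex_model oppr_eq0 mulf_neq0 ?expf_neq0.
rewrite (has_j_invariantE _ n2 n3 uM c0 (flex_substE a b)) D0 /weierstrass_j.
have jE : j_equation iota a b =
    c4 (flex_model a b) ^+ 3 - iota * weierstrass_disc (flex_model a b).
  by rewrite c4_flex_model weierstrass_disc_flex_model /j_equation; ring.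
rewrite jE; split=> [[_ ->]|/eqP].
  by rewrite divfK // subrr.
by rewrite subr_eq0 => /eqP ->; rewrite mulfK.
Qed.

(** * The equation of degree 12 *)

Lemma rmorph_j_equation (R S : comNzRingType) (f : {rmorphism R -> S})
    (iota a b : R) :
  f (j_equation iota a b) = j_equation (f iota) (f a) (f b).
Proof. by rewrite /j_equation /flex_coef; ring. Qed.

Lemma horner_j_equation (L : fieldType) (iota a b : L) :
  (j_equation iota%:P a%:P 'X).[b] = j_equation iota a b.
Proof.
by rewrite -[LHS]/(horner_eval b _) rmorph_j_equation /= !horner_evalE !hornerE.
Qed.

Lemma map_j_equation (K L : fieldType) (f : {rmorphism K -> L}) (iota a : K) :
  map_poly f (j_equation iota%:P a%:P 'X)
  = j_equation (f iota)%:P (f a)%:P 'X.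
Proof. by rewrite rmorph_j_equation /= !map_polyC map_polyX. Qed.

Lemma flex_coef_poly (L : fieldType) (a : L) : flex_coef a%:P 'X =
  2 *: 'X^3 + (- (1 + 3 * a) *: 'X^2 + (a * (1 - 3 * a + 9 * a ^+ 2))%:P).
Proof. by rewrite /flex_coef -!mul_polyC; ring. Qed.

(** The chain rule: the first factor is dE/db. *)
Lemma deriv_j_equation (L : fieldType) (iota a b : L) :
  (j_equation iota%:P a%:P 'X)^`().[b] =
  2 * b * (3 * b - (1 + 3 * a)) *
  (72 * (1 - 6 * a) ^+ 3 * ((1 - 6 * a) ^+ 3 + 24 * flex_coef a b) ^+ 2
   + iota * flex_coef a b ^+ 2
     * (3 * ((1 - 6 * a) ^+ 3 + 36 * flex_coef a b))).
Proof.
rewrite /j_equation; set E := flex_coef a%:P 'X.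
pose N : {poly L} := 1 - 6 * a%:P.
have Eb : E.[b] = flex_coef a b.
  by rewrite /E flex_coef_poly !(hornerD, hornerZ, hornerXn, hornerC)
    /flex_coef; ring.
have dEb : E^`().[b] = 2 * b * (3 * b - (1 + 3 * a)).
  rewrite /E flex_coef_poly !(derivD, derivZ, derivXn, derivC) /=.
  by rewrite !(hornerD, hornerZ, hornerMn, hornerXn, hornerC); ring.
rewrite -/N; move: E Eb dEb => E Eb dEb.
have -> : N ^+ 3 * (N ^+ 3 + 24 * E) ^+ 3
          + iota%:P * (E ^+ 3 * (N ^+ 3 + 27 * E))
  = (1 - 6 * a) ^+ 3 *: ((((1 - 6 * a) ^+ 3)%:P + 24 *: E)
       * (((1 - 6 * a) ^+ 3)%:P + 24 *: E) * (((1 - 6 * a) ^+ 3)%:P + 24 *: E))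
  + iota *: (E * E * E * (((1 - 6 * a) ^+ 3)%:P + 27 *: E)).
  by rewrite /N -!mul_polyC; ring.
rewrite !(derivD, derivZ, derivM, derivC).
rewrite !(hornerD, hornerZ, hornerM, hornerC) Eb dEb.
by ring.
Qed.

Lemma size_flex_coef (L : fieldType) (a : L) : 2 != 0 :> L ->
  size (flex_coef a%:P 'X) = 4%N.
Proof.
move=> n2; have s4 : size (2 *: 'X^3 : {poly L}) = 4%N.
  by rewrite size_scale ?size_polyXn.
rewrite flex_coef_poly size_polyDl // s4 ltnS.
apply: leq_trans (size_polyD _ _) _; rewrite geq_max.
rewrite (leq_trans (size_scale_leq _ _)) ?size_polyXn //=.
by rewrite (leq_trans (size_polyC_leq1 _)).
Qed.

Lemma size_j_equation (L : fieldType) (iota a : L) :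
  2 != 0 :> L -> 3 != 0 :> L -> iota != 0 ->
  size (j_equation iota%:P a%:P 'X) = 13%N.
Proof.
move=> n2 n3 iota0; set E := flex_coef a%:P 'X.
have sE : size E = 4%N := size_flex_coef a n2.
have sNE c : (size (((1 - 6 * a) ^+ 3)%:P + c *: E)%R <= 4)%N.
  apply: leq_trans (size_polyD _ _) _; rewrite geq_max.
  rewrite (leq_trans (size_polyC_leq1 _)) //.
  by rewrite (leq_trans (size_scale_leq _ _)) ?sE.
have n27 : 27 != 0 :> L := natr_pow2_pow3_neq0 0 3 n2 n3.
have sN27 : size (((1 - 6 * a) ^+ 3)%:P + 27 *: E) = 4%N.
  rewrite addrC size_polyDl size_scale // sE // ltnS.
  by rewrite (leq_trans (size_polyC_leq1 _)).
have sE3 : size (E ^+ 3) = 10%N.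
  by have := size_exp E 3; rewrite sE; case: (size _) => //= k ->.
have -> : j_equation iota%:P a%:P 'X =
  iota *: (E ^+ 3 * (((1 - 6 * a) ^+ 3)%:P + 27 *: E))
  + (1 - 6 * a) ^+ 3 *: (((1 - 6 * a) ^+ 3)%:P + 24 *: E) ^+ 3.
  by rewrite /j_equation -/E -!mul_polyC; ring.
have s13 : size (iota *: (E ^+ 3 * (((1 - 6 * a) ^+ 3)%:P + 27 *: E))) = 13%N.
  by rewrite size_scale // size_mul -?size_poly_eq0 ?sE3 ?sN27.
rewrite size_polyDl s13 // ltnS; apply: leq_trans (size_scale_leq _ _) _.
apply: leq_trans (size_exp_leq _ _) _.
have := sNE 24; case: (size _) => [|k] //=; rewrite ltnS => k3.
by apply: leq_ltn_trans (leq_mul k3 (leqnn 3)) _.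
Qed.

(** * Valuations and the number of roots in the maximal ideal *)

Section Valuations.
Context (R : realType) (K : fieldType) (v : valuation R K).
Implicit Types (x y : K) (p q : {poly K}) (k l : nat).

Local Notation O := (valuation_ring v).

Lemma integralE x : (x \in O) = (0 <= v x)%E.
Proof. by []. Qed.

Lemma valuationD_lt x y : (v x < v y)%E -> v (x + y) = v x.
Proof.
move=> xy; apply/eqP; rewrite eq_le; apply/andP; split.
  have := valuationD v (x + y) (- y); rewrite addrK valuationN.
  by rewrite ge_min => /orP[//|]; rewrite leNgt xy.
by apply: le_trans (valuationD v x y); rewrite le_min lexx ltW.
Qed.

Lemma valuationD_gt0 x y :
  (0 < v x)%E -> (0 < v y)%E -> (0 < v (x + y)%R)%E.
Proof.
by move=> x0 y0; apply: lt_le_trans (valuationD v x y); rewrite lt_min x0.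
Qed.

Lemma valuation_unitD x y : v x = 0%E -> (0 < v y)%E -> v (x + y) = 0%E.
Proof. by move=> x0 y0; rewrite valuationD_lt x0. Qed.

Lemma valuationM_gt0l x y : (0 < v x)%E -> y \in O -> (0 < v (x * y)%R)%E.
Proof. by move=> x0 y0; rewrite valuationM lte_paddr. Qed.

Lemma valuationM_gt0r x y : x \in O -> (0 < v y)%E -> (0 < v (x * y)%R)%E.
Proof. by move=> x0 y0; rewrite mulrC valuationM_gt0l. Qed.

Lemma valuation_unitM x y : v x = 0%E -> v y = 0%E -> v (x * y) = 0%E.
Proof. by move=> x0 y0; rewrite valuationM x0 y0 add0e. Qed.

Lemma valuation_unitX x n : v x = 0%E -> v (x ^+ n) = 0%E.
Proof.
move=> x0; elim: n => [|n IH]; first by rewrite expr0 valuation1.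
by rewrite exprS valuation_unitM.
Qed.

Lemma valuation_unit_neq0 x : v x = 0%E -> x != 0.
Proof. by apply: contra_eq_neq => ->; rewrite valuation0. Qed.

Lemma valuation_gt0_integral x : (0 < v x)%E -> x \in O.
Proof. by move=> /ltW. Qed.

Lemma valuation_unit_integral x : v x = 0%E -> x \in O.
Proof. by rewrite integralE => ->. Qed.

Lemma valuation_natr (n : nat) : prime n ->
  n \notin [pchar (residue_field v)] -> v n%:R = 0%E.
Proof.
move=> pn; rewrite inE pn /=; apply: contraNeq => vn.
have vn0 : (0 < v n%:R)%E by rewrite lt_neqAle eq_sym vn -integralE rpred_nat.
have -> : n%:R = \pi_({ideal_quot (valuation_ideal v)})%qT (n%:R : valring v)
   :> residue_field v by rewrite rmorph_nat.
rewrite -[0](rmorph0 (\pi_({ideal_quot (valuation_ideal v)})%qT)).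
rewrite -Quotient.idealrBE subr0 unfold_in /valuation_ideal.
by rewrite -[vrval _]/(val _) rmorph_nat.
Qed.

(** The reduction of p modulo the maximal ideal vanishes at 0 to order exactly
k.  Stating this on the coefficients avoids the passage to the residue field. *)
Definition order_at k p := [/\ p \is a polyOver O,
  forall i, (i < k)%N -> (0 < v p`_i)%E & v p`_k = 0%E].

Lemma order_at1 : order_at 0 1.
Proof. by split; rewrite ?rpred1 // coef1 valuation1. Qed.

(** In the coefficient of degree k + l of a product, all terms but p_k q_l lie
in the maximal ideal, as in the lemma of Gauss. *)
Lemma order_atM k l p q :
  order_at k p -> order_at l q -> order_at (k + l) (p * q).
Proof.
move=> [/polyOverP pO pk0 pk] [/polyOverP qO ql0 ql]; split.
- by apply: rpredM; apply/polyOverP.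
- move=> i ikl; rewrite coefM.
  apply: (big_ind (fun x => 0 < v x)%E); rewrite ?valuation0 ?ltry //.
    exact: valuationD_gt0.
  move=> j _; have [jk|kj] := ltnP j k.
    by apply: valuationM_gt0l => //; apply: pk0.
  have ijl : (i - j < l)%N.
    rewrite ltn_subLR -1?ltnS //.
    by apply: leq_trans ikl _; rewrite leq_add2r.
  by apply: valuationM_gt0r => //; apply: ql0.
- have kkl : (k < (k + l).+1)%N by rewrite ltnS leq_addr.
  rewrite coefM (bigD1 (Ordinal kkl)) //= addKn.
  rewrite valuation_unitD ?valuation_unitM //.
  apply: (big_ind (fun x => 0 < v x)%E); rewrite ?valuation0 ?ltry //.
    exact: valuationD_gt0.
  move=> j; rewrite -val_eqE /= neq_ltn => /orP[jk|kj].
    by apply: valuationM_gt0l => //; apply: pk0.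
  have ijl : (k + l - j < l)%N by rewrite ltn_subLR ?ltn_add2r // -ltnS.
  by apply: valuationM_gt0r => //; apply: ql0.
Qed.

Lemma order_atX k p n : order_at k p -> order_at (n * k) (p ^+ n).
Proof.
move=> pk; elim: n => [|n IH]; last by rewrite mulSn exprS; apply: order_atM.
rewrite expr0; exact: order_at1.
Qed.

Lemma order_atD k p q : order_at k p -> (forall i, 0 < v q`_i)%E ->
  order_at k (p + q).
Proof.
move=> [pO pk0 pk] q0; split.
- by apply: rpredD => //; apply/polyOverP => i; apply: valuation_gt0_integral.
- by move=> i ik; rewrite coefD valuationD_gt0 ?pk0.
- by rewrite coefD valuation_unitD.
Qed.

(** Both polynomials are primitive, so c is a unit. *)
Lemma order_at_uniq k l p c : order_at k p -> order_at l (c *: p) -> k = l.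
Proof.
move=> [/polyOverP pO pk0 pk] [/polyOverP qO ql0 ql].
have c0 : v c = 0%E.
  apply/eqP; rewrite eq_le; apply/andP; split; last first.
    by have := qO k; rewrite coefZ integralE valuationM pk adde0.
  by rewrite -[leRHS]ql coefZ valuationM lee_paddr // -integralE.
have cE i : v (c *: p)`_i = v p`_i by rewrite coefZ valuationM c0 add0e.
case: (ltngtP k l) => // [/ql0|/pk0]; first by rewrite cE pk ltxx.
by rewrite -cE ql ltxx.
Qed.

(** A root outside the maximal ideal has an integral inverse, and X / r - 1 is
a unit at 0. *)
Lemma order_at_linear (r : K) :
  exists c, order_at (0 < v r)%E (c *: ('X - r%:P)).
Proof.
have [r0|r0] := boolP (0 < v r)%E.
  exists 1; rewrite scale1r; split=> [|[|//] _|].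
  - by rewrite rpredB ?polyOverX ?polyOverC ?valuation_gt0_integral.
  - by rewrite coefB coefX coefC sub0r valuationN.
  - by rewrite coefB coefX coefC subr0 valuation1.
have rn0 : r != 0 by apply: contraNneq r0 => ->; rewrite valuation0 ltry.
have rV : r^-1 \in O.
  have := valuationM v r r^-1; rewrite divff // valuation1 integralE.
  move: r0; rewrite -leNgt; case: (v r) => [s| |]; case: (v r^-1) => [t| |] //.
  by rewrite -EFinD !lee_fin => s0 [e]; lra.
exists r^-1; split=> //.
- rewrite scalerBr -[X in _ - X]mul_polyC -polyCM mulVf // rpredB ?rpred1 //.
  by rewrite polyOverZ ?polyOverX.
- by rewrite coefZ coefB coefX coefC sub0r mulrN valuationN mulVf // valuation1.
Qed.

Lemma order_at_prod (rs : seq K) : exists c,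
  order_at (count (fun r => 0 < v r)%E rs) (c *: \prod_(r <- rs) ('X - r%:P)).
Proof.
elim: rs => [|r rs [c IH]].
  by exists 1; rewrite big_nil scale1r; exact: order_at1.
have [d dr] := order_at_linear r; exists (d * c).
by rewrite big_cons -scalerA scalerAr scalerAl /=; apply: order_atM.
Qed.

(** The part of the Newton polygon argument that is needed: for a split
polynomial, the order of its reduction at 0 counts the roots of positive
valuation. *)
Lemma order_at_count k c p (rs : seq K) :
  p = c *: \prod_(r <- rs) ('X - r%:P) ->
  order_at k p -> count (fun r => 0 < v r)%E rs = k.
Proof.
move=> pE pk; have [d drs] := order_at_prod rs.
have c0 : c != 0.
  by apply/eqP => c0; case: pk => _ _; rewrite pE c0 scale0r coef0 valuation0.
symmetry; apply: order_at_uniq pk (_ : order_at _ ((d / c) *: p)).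
by rewrite pE scalerA mulfVK.
Qed.

End Valuations.

(** * Solutions of positive valuation *)

Section PositiveSolutions.
Context (R : realType) (L : fieldType) (w : valuation R L) (iota a : L).
Hypotheses (wiota : (w iota < 0)%E) (waiota : (0 < w a + w iota)%E).

Local Notation O := (valuation_ring w).
Local Notation N := (1 - 6 * a).

Lemma iota_neq0 : iota != 0.
Proof. by apply: contraTneq wiota => ->; rewrite valuation0. Qed.

Lemma valuation_iotaE : exists2 n : R, 0 < n & w iota = (- n)%:E.
Proof.
have := valuation_fin w iota_neq0; move: wiota.
case: (w iota) => // r; rewrite lte_fin => r0 _.
by exists (- r); rewrite ?opprK ?oppr_gt0.
Qed.

Lemma valuation_a_gt n : w iota = (- n)%:E -> (n%:E < w a)%E.
Proof.
move=> E; move: waiota; rewrite E; case: (w a) => [r| |] //; rewrite ?ltry //.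
by rewrite -EFinD !lte_fin subr_gt0.
Qed.

Lemma valuation_a_gt0 : (0 < w a)%E.
Proof.
have [n n0 E] := valuation_iotaE.
by apply: lt_trans (valuation_a_gt E); rewrite lte_fin.
Qed.

Lemma a_integral : a \in O.
Proof. exact: valuation_gt0_integral valuation_a_gt0. Qed.

Lemma unit_N : w N = 0%E.
Proof.
rewrite valuation_unitD ?valuation1 // -mulNr valuationM_gt0r //.
  by rewrite rpredN rpred_nat.
exact: valuation_a_gt0.
Qed.

Lemma valuation_flex_coef0 : w (a * (1 - 3 * a + 9 * a ^+ 2)) = w a.
Proof.
rewrite (_ : 1 - _ + _ = 1 + a * (9 * a - 3)); last by ring.
rewrite valuationM valuation_unitD ?valuation1 ?adde0 //.
rewrite valuationM_gt0l ?valuation_a_gt0 //.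
by rewrite rpredB ?rpredM ?rpred_nat ?a_integral.
Qed.

Section PositiveB.
Context (b : L) (wb : (0 < w b)%E).
Local Notation E := (flex_coef a b).

Lemma unit_1_3a_cb c : c \in O -> w (1 + 3 * a - c * b) = 0%E.
Proof.
move=> cO; rewrite -addrA valuation_unitD ?valuation1 // valuationD_gt0 //.
  by rewrite valuationM_gt0r ?rpred_nat ?valuation_a_gt0.
by rewrite valuationN valuationM_gt0r.
Qed.

Lemma flex_coefE :
  E = a * (1 - 3 * a + 9 * a ^+ 2) - b ^+ 2 * (1 + 3 * a - 2 * b).
Proof. by rewrite /flex_coef; ring. Qed.

Lemma valuation_flex_coef2 : w (b ^+ 2 * (1 + 3 * a - 2 * b)) = w (b ^+ 2).
Proof. by rewrite valuationM unit_1_3a_cb ?rpred_nat // adde0. Qed.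

Lemma flex_coef_gt0 : (0 < w E)%E.
Proof.
rewrite flex_coefE valuationD_gt0 ?valuation_flex_coef0 ?valuation_a_gt0 //.
rewrite valuationN valuation_flex_coef2 expr2 valuationM_gt0l //.
exact: valuation_gt0_integral.
Qed.

Lemma unit_N3_cE c : c \in O -> w (N ^+ 3 + c * E) = 0%E.
Proof.
move=> cO; rewrite valuation_unitD ?valuation_unitX ?unit_N //.
by rewrite valuationM_gt0r ?flex_coef_gt0.
Qed.

(** In the equation, iota E^3 is the only factor that is not a unit. *)
Lemma root_valuation_flex_coef n : w iota = (- n)%:E ->
  j_equation iota a b = 0 -> w E = (n / 3)%:E.
Proof.
move=> wi /eqP; rewrite /j_equation addrC addr_eq0 => /eqP /(congr1 w).
rewrite valuationN !valuationM !unit_N3_cE ?rpred_nat // unit_N.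
rewrite !(adde0, add0e) wi.
have := flex_coef_gt0; case: (w E) => [e| |] // _.
by rewrite -!EFinD => -[e3]; congr _%:E; lra.
Qed.

(** As val(E) < val(a), the term of E in b^2 is the dominant one. *)
Lemma root_valuation_sqr n : w iota = (- n)%:E ->
  j_equation iota a b = 0 -> w (b ^+ 2) = (n / 3)%:E.
Proof.
move=> wi j0; have wE := root_valuation_flex_coef wi j0.
have wEa : (w E < w a)%E.
  have n0 : 0 < n by move: wiota; rewrite wi lte_fin oppr_lt0.
  by apply: le_lt_trans (valuation_a_gt wi); rewrite wE lee_fin; lra.
rewrite -wE -valuation_flex_coef2.
rewrite (_ : b ^+ 2 * _ = - E + a * (1 - 3 * a + 9 * a ^+ 2)).
  by rewrite valuationD_lt valuationN // valuation_flex_coef0.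
by rewrite flex_coefE; ring.
Qed.

Lemma root_honeycomb : j_equation iota a b = 0 ->
  b != 0 /\ (0 < w (a / b ^+ 2)%R)%E.
Proof.
move=> j0; have [n n0 wi] := valuation_iotaE.
have wbb := root_valuation_sqr wi j0.
have b0 : b != 0.
  by apply/eqP => b0; move: wbb; rewrite b0 expr0n valuation0.
split=> //; have := valuation_a_gt wi.
rewrite -{1}(divfK (expf_neq0 2 b0) a) (valuationM _ (a / _)) wbb.
case: (w (a / _)) => [r| |] //; rewrite ?ltry //.
by rewrite -EFinD !lte_fin => ?; lra.
Qed.

(** Under the honeycomb conditions the term of E in b^2 dominates, so E does
not vanish. *)
Lemma honeycomb_disc_neq0 : b != 0 -> (0 < w (a / b ^+ 2)%R)%E ->
  [/\ 1 + 3 * a - 3 * b != 0, E != 0 & N ^+ 3 + 27 * E != 0].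
Proof.
move=> b0 wab; have wb2 := valuation_fin w (expf_neq0 2 b0).
have wE : w E = w (b ^+ 2).
  rewrite flex_coefE addrC valuationD_lt valuationN valuation_flex_coef2 //.
  rewrite valuation_flex_coef0 -[in ltRHS](divfK (expf_neq0 2 b0) a).
  by rewrite (valuationM _ (a / _)) lteDr.
split.
- exact: valuation_unit_neq0 (unit_1_3a_cb (rpred_nat _ 3)).
- by apply: contraTneq wb2 => E0; rewrite -wE E0 valuation0.
- exact: valuation_unit_neq0 (unit_N3_cE (rpred_nat _ 27)).
Qed.

(** In the derivative of the equation with respect to E, the term with iota has
valuation val(iota) + 2 val(E) = val(iota) / 3 < 0, while the other term is
integral. *)
Lemma j_equation_simple : w 2 = 0%E -> w 3 = 0%E -> j_equation iota a b = 0 ->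
  (j_equation iota%:P a%:P 'X)^`().[b] != 0.
Proof.
move=> w2 w3 j0; have [n n0 wi] := valuation_iotaE.
have [b0 _] := root_honeycomb j0.
rewrite deriv_j_equation; apply: mulf_neq0.
  apply: mulf_neq0; first by rewrite mulf_neq0 // (valuation_unit_neq0 w2).
  by rewrite -opprB oppr_eq0 (valuation_unit_neq0 (unit_1_3a_cb _)) ?rpred_nat.
apply/eqP => /eqP; rewrite addrC addr_eq0 => /eqP /(congr1 w).
rewrite valuationN [in LHS]valuationM.
rewrite (valuation_unitM w3) ?unit_N3_cE ?rpred_nat // valuationM wi expr2.
rewrite valuationM (root_valuation_flex_coef wi j0) adde0 -!EFinD => wr.
have : (0 <= (- n + (n / 3 + n / 3))%:E)%E.
  rewrite wr -integralE; apply: rpredM.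
    apply: rpredM; first exact: rpred_nat.
    exact/rpredX/valuation_unit_integral/unit_N.
  exact/rpredX/valuation_unit_integral/unit_N3_cE/rpred_nat.
by rewrite lee_fin; lra.
Qed.

End PositiveB.

(** After division by iota the equation is congruent to E^3 (N^3 + 27 E), where
the first factor contributes 3 * 2 since E is congruent to - b^2 * unit. *)
Lemma order_at_j_equation :
  order_at w 6 (iota^-1 *: j_equation iota%:P a%:P 'X).
Proof.
have [n n0 wi] := valuation_iotaE.
have wiV : (0 < w iota^-1%R)%E.
  have := valuationM w iota iota^-1; rewrite divff ?iota_neq0 // valuation1 wi.
  case: (w iota^-1) => [r| |] //; rewrite -EFinD => -[e]; rewrite lte_fin.
  by lra.
have aO : a \in O := a_integral.
set E := flex_coef a%:P 'X : {poly L}.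
have E2 : order_at w 2 E.
  rewrite /E flex_coef_poly addrA; apply: order_atD; last first.
    move=> i; rewrite coefC; case: eqP => _; last by rewrite valuation0 ltry.
    by rewrite valuation_flex_coef0 valuation_a_gt0.
  split.
  - rewrite rpredD ?polyOverZ ?rpredX ?polyOverX ?rpred_nat //.
    by rewrite rpredN rpredD ?rpred1 ?rpredM ?rpred_nat.
  - move=> [|[|//]] _;
    by rewrite coefD !coefZ !coefXn !mulr0 addr0 valuation0 ltry.
  - rewrite coefD !coefZ !coefXn mulr0 add0r mulr1 valuationN.
    rewrite valuation_unitD ?valuation1 // valuationM_gt0r ?rpred_nat //.
    exact: valuation_a_gt0.
have EO : E \is a polyOver O by case: E2.
have NO : N ^+ 3 \in O by rewrite rpredX // (valuation_unit_integral unit_N).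
have NEO c : c \in O -> (N ^+ 3)%:P + c *: E \is a polyOver O.
  by move=> cO; rewrite rpredD ?polyOverC ?polyOverZ.
have NE0 : order_at w 0 ((N ^+ 3)%:P + 27 *: E).
  split=> //; first by rewrite NEO ?rpred_nat.
  rewrite coefD coefC coefZ valuation_unitD ?valuation_unitX ?unit_N //.
  by rewrite valuationM_gt0r ?rpred_nat //; case: E2 => _ -> .
have -> : iota^-1 *: j_equation iota%:P a%:P 'X =
  E ^+ 3 * ((N ^+ 3)%:P + 27 *: E)
  + iota^-1 *: ((N ^+ 3)%:P * ((N ^+ 3)%:P + 24 *: E) ^+ 3).
  rewrite -[E ^+ 3 * _](scalerK iota_neq0) -scalerDr.
  by congr (_ *: _); rewrite /j_equation -/E -!mul_polyC; ring.
apply: order_atD.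
  by rewrite -[6%N]addn0; apply: order_atM => //; exact: (order_atX 3 E2).
move=> i; rewrite coefZ valuationM_gt0l //.
suff /polyOverP : (N ^+ 3)%:P * ((N ^+ 3)%:P + 24 *: E) ^+ 3 \is a polyOver O.
  by [].
by rewrite rpredM ?rpredX ?NEO ?polyOverC ?rpred_nat.
Qed.

End PositiveSolutions.

Lemma count_mem_simple_root (L : fieldType) (c x : L) (p : {poly L})
    (rs : seq L) :
  p = c *: \prod_(r <- rs) ('X - r%:P) -> p^`().[x] != 0 ->
  x \in rs -> count_mem x rs = 1%N.
Proof.
move=> pE dp xrs; have rsE := perm_to_rem xrs.
rewrite (permP rsE) /= eqxx; congr _.+1; apply/count_memPn.
apply: contraNN dp => xrs'; rewrite pE (perm_big _ rsE) /= big_cons.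
rewrite derivZ derivM derivXsubC mul1r hornerZ hornerD hornerM hornerXsubC.
rewrite subrr mul0r addr0 mulf_eq0; apply/orP; right.
by rewrite -[_ == _]/(root _ _) root_prod_XsubC.
Qed.

Lemma uniq_filter_simple_roots (L : fieldType) (c : L) (p : {poly L})
    (rs : seq L) (S : pred L) :
  p = c *: \prod_(r <- rs) ('X - r%:P) ->
  (forall x, x \in rs -> S x -> p^`().[x] != 0) -> uniq (filter S rs).
Proof.
move=> pE dp; apply: count_mem_uniq => x.
have [|xNrs] := boolP (x \in filter S rs); last exact/count_memPn.
rewrite mem_filter => /andP[Sx xrs]; rewrite count_filter.
rewrite -[RHS](count_mem_simple_root pE (dp x xrs Sx) xrs).
by apply: eq_count => y /=; case: eqP => // ->; rewrite Sx.
Qed.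

Theorem proposition1 (R : realType) (K : fieldType) (v : valuation R K)
    (char_residue2 : 2%N \notin [pchar (residue_field v)])
    (char_residue3 : 3%N \notin [pchar (residue_field v)])
    (L : closedFieldType) (incl : {rmorphism K -> L})
    (L_algebraic : forall x : L, algebraicOver incl x)
    (w : valuation R L) (w_extends_v : forall x : K, w (incl x) = v x)
    (iota a : K)
    (val_iota : (v iota < 0)%E) (val_a_iota : (0 < v a + v iota)%E) :
  exists (s : seq L) (P : {poly K}),
    [/\ uniq s /\ size s = 6%N,
        forall b : L, b \in s <->
          [/\ nonsingular (symmetric_cubic (incl a) b),
              has_j_invariant (symmetric_cubic (incl a) b) (incl iota)
            & symmetric_honeycomb_form w (symmetric_cubic (incl a) b)],
        size P = 13%N
      & forall b : L, b \in s -> root (map_poly incl P) b].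
Proof.
have v2 := valuation_natr (isT : prime 2) char_residue2.
have v3 := valuation_natr (isT : prime 3) char_residue3.
have w2 : w 2 = 0%E by rewrite -(rmorph_nat incl) w_extends_v.
have w3 : w 3 = 0%E by rewrite -(rmorph_nat incl) w_extends_v.
have n2 := valuation_unit_neq0 w2; have n3 := valuation_unit_neq0 w3.
have wi : (w (incl iota) < 0)%E by rewrite w_extends_v.
have wai : (0 < w (incl a) + w (incl iota))%E by rewrite !w_extends_v.
set P : {poly K} := j_equation iota%:P a%:P 'X.
have sP : size P = 13%N.
  apply: size_j_equation (valuation_unit_neq0 v2) (valuation_unit_neq0 v3) _.
  exact: iota_neq0 val_iota.
pose p := map_poly incl P.
have pE : p = j_equation (incl iota)%:P (incl a)%:P 'X := map_j_equation _ _ _.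
have [rs] := closed_field_poly_normal p; set c := lead_coef p => prs.
have c0 : c != 0 by rewrite lead_coef_eq0 -size_poly_eq0 size_map_poly sP.
have rootE b : root p b = (b \in rs) by rewrite prs rootZ // root_prod_XsubC.
have rsP b : b \in rs <-> j_equation (incl iota) (incl a) b = 0.
  by rewrite -horner_j_equation -pE -rootE; split=> /eqP.
exists [seq b <- rs | (0 < w b)%E], P; split=> //.
- split.
    apply: uniq_filter_simple_roots prs _ => b /rsP j0 wb.
    by rewrite pE; apply: (j_equation_simple wi wai wb).
  rewrite size_filter; apply: order_at_count (order_at_j_equation wi wai).
  by rewrite -pE prs scalerA.
- move=> b; rewrite mem_filter; split=> [/andP[wb /rsP j0]|[_ hj]].
    have [b0 wab] := root_honeycomb wi wai wb j0.
    have [m0 E0 F0] := honeycomb_disc_neq0 wi wai wb b0 wab.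
    split; first exact: symmetric_cubic_nonsingular.
      exact/has_j_invariant_symmetric.
    exact/symmetric_honeycomb_formE.
  move=> /symmetric_honeycomb_formE[b0 wb wab].
  have [m0 E0 F0] := honeycomb_disc_neq0 wi wai wb b0 wab.
  rewrite wb; apply/rsP.
  exact/(has_j_invariant_symmetric _ n2 n3 m0 E0 F0).
- by move=> b; rewrite mem_filter -/p rootE => /andP[].
Qed.
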